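(* Let $n\ge1$, $r\ge2$ an integer, for each $1\le j\le n$ let $A_j\subseteq\{0,\dots,r-1\}$ be a nonempty set of integers, $\mathcal{K}_j$ the attractor of $\{x\mapsto(x+a)/r:a\in A_j\}$, $\gamma_j=\log\#A_j/\log r$, and $\mathcal{K}=\prod_{j=1}^n\mathcal{K}_j$. Suppose $\boldsymbol{\tau}=(\tau_1,\dots,\tau_n)\in\mathbb{R}_+^n$ satisfies $\sum_{i=1}^n\tau_i\gamma_i=1$. Then there is a constant $C>0$ such that for any $\mathbf{x}=(x_1,\dots,x_n)\in\mathcal{K}$ and any $Q>r$ there exists $\mathbf{p}/q=(p_1/q,\dots,p_n/q)\in\mathbb{Q}^n\cap\mathcal{K}$ with $q\le Q$ such that $$\Big|x_i-\frac{p_i}{q}\Big|<\frac{C}{q(\log Q)^{\tau_i}}\qquad(1\le i\le n).$$ *)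

(* Defs.v *)
From mathcomp Require Import all_boot all_order all_algebra.
From mathcomp Require Import all_classical all_reals all_analysis.

Set Implicit Arguments.
Unset Strict Implicit.
Unset Printing Implicit Defensive.

Import Order.TTheory GRing.Theory Num.Theory.
Import numFieldNormedType.Exports.

Local Open Scope classical_set_scope.
Local Open Scope ring_scope.

(* By Hutchinson's theorem, a finite nonempty family of contractions of a
   complete metric space has exactly one attractor in this sense. *)
Definition is_attractor (T : topologicalType) (I : Type) (D : set I)
    (f : I -> T -> T) (K : set T) : Prop :=
  [/\ K !=set0, compact K & K = \bigcup_(a in D) (f a @` K)].

Definition digit_map (R : realType) (r : nat) (a : 'I_r) (x : R) : R :=
  (x + a%:R) / r%:R.

Definition digit_dim (R : realType) (r : nat) (A : {set 'I_r}) : R :=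
  ln (#|A|%:R) / ln (r%:R).

Definition box (R : realType) (n : nat) (K : 'I_n -> set R) : set 'rV[R]_n :=
  [set x | forall j, K j (x ord0 j)].

(* Main.v *)
(* Let $y_k$ be the image of $x \in \mathcal K$ after deleting the first $k$
   base $r$ digits of every coordinate.  Put $N = \lfloor \log_r Q \rfloor$
   and $m_i = \lfloor \tau_i \log_r N \rfloor$.  As $\sum \tau_i \gamma_i = 1$,
   there are at most $N$ ways to choose, for every $i$, a word of length $m_i$
   over $A_i$, so two of $y_0, ..., y_N$, say $y_k$ and $y_l$ with $k < l$,
   start with the same words.  Repeating the digits in positions $k + 1, ..., l$
   for ever gives a rational point $p / q$ of $\mathcal K$ with
   $q = r^k (r^{l-k} - 1)$ and $x - p / q = (y_l - y_k) / q$, where the $i$-th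
   coordinate of $y_l - y_k$ is $O(r^{-m_i}) = O((\log Q)^{-\tau_i})$. *)
Require Import Defs.
From mathcomp Require Import all_boot all_order all_algebra.
From mathcomp Require Import all_classical all_reals all_analysis.
From mathcomp Require Import ring.

Set Implicit Arguments.
Unset Strict Implicit.
Unset Printing Implicit Defensive.

Import Order.TTheory GRing.Theory Num.Theory.
Import numFieldNormedType.Exports.

Local Open Scope classical_set_scope.
Local Open Scope ring_scope.

(** [y k] is the tail left after deleting [k] digits. Carrying the tails with the digits replaces
    infinite series by a recurrence and keeps every tail in [K], where it is bounded. *)
Definition expansion (R : realType) (r : nat) (A : {set 'I_r}) (K : set R)
    (d : nat -> 'I_r) (y : nat -> R) : Prop :=
  forall k, [/\ d k \in A, K (y k) & y k = digit_map (d k) (y k.+1)].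

Lemma attractor_expansion (R : realType) (r : nat) (A : {set 'I_r})
    (K : set R) (x : R) :
  is_attractor [set a | a \in A] (@digit_map R r) K -> K x ->
  exists d y, expansion A K d y /\ y 0%N = x.
Proof.
move=> [_ _ Keq] Kx.
pose next (u v : {t : R | K t}) :=
  exists2 a, a \in A & sval u = digit_map a (sval v).
have nextP u : {v | next u v}.
  apply: cid; case: u => t Kt.
  have := Kt; rewrite {1}Keq => -[a Aa [z Kz zt]].
  by exists (exist _ z Kz), a.
have [f [f0 fS]] := dependent_choice nextP (exist _ x Kx).
pose d k := sval (cid2 (fS k)).
exists d, (fun k => sval (f k)); split; last by rewrite f0.
move=> k; rewrite /d; case: cid2 => a Aa fk /=; split => //.
exact: (svalP (f k)).
Qed.

(** The integer with base [r] digits [d k, ..., d (k + m - 1)], most significant first. *)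
Fixpoint block (r : nat) (d : nat -> 'I_r) (k m : nat) : nat :=
  if m is m'.+1 then (block d k m' * r + d (k + m'))%N else 0%N.

Lemma eq_block (r : nat) (d : nat -> 'I_r) (k l m : nat) :
  (forall s, (s < m)%N -> d (k + s)%N = d (l + s)%N) ->
  block d k m = block d l m.
Proof.
elim: m => //= m IHm dE; rewrite dE // IHm // => s sm.
by rewrite dE // ltnS ltnW.
Qed.

Lemma expansion_block (R : realType) (r : nat) (A : {set 'I_r}) (K : set R)
    (d : nat -> 'I_r) (y : nat -> R) (k m : nat) : (0 < r)%N ->
  expansion A K d y ->
  y k = (y (k + m)%N + (block d k m)%:R) / r%:R ^+ m.
Proof.
move=> r_gt0 dy; have r_neq0 : r%:R != 0 :> R by rewrite pnatr_eq0 -lt0n.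
elim: m => [|m IHm]; first by rewrite addn0 /= addr0 expr0 divr1.
have [_ _ ykm] := dy (k + m)%N.
rewrite IHm ykm addnS /= /digit_map natrD natrM exprS.
by field; rewrite expf_neq0 // r_neq0.
Qed.

Lemma attractor_block (R : realType) (r : nat) (A : {set 'I_r}) (K : set R)
    (d : nat -> 'I_r) (k m : nat) (t : R) : (0 < r)%N ->
  is_attractor [set a | a \in A] (@digit_map R r) K ->
  (forall s, d s \in A) -> K t ->
  K ((t + (block d k m)%:R) / r%:R ^+ m).
Proof.
move=> r_gt0 [_ _ Keq] dA.
have r_neq0 : r%:R != 0 :> R by rewrite pnatr_eq0 -lt0n.
elim: m t => [|m IHm] t Kt; first by rewrite /= addr0 expr0 divr1.
have Kt' : K (digit_map (d (k + m)%N) t).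
  by rewrite Keq; exists (d (k + m)%N); [exact: dA|exists t].
rewrite [X in K X](_ : _ = (digit_map (d (k + m)%N) t + (block d k m)%:R)
  / r%:R ^+ m); first exact: IHm.
rewrite /= /digit_map natrD natrM exprS.
by field; rewrite expf_neq0 // r_neq0.
Qed.

(** [c / (rho - 1)] is the fixed point of the contraction [u -> (u + c) / rho]. The iterates of [t],
    written in closed form below, stay in [K] and converge to it. *)
Lemma closed_affine_fixpoint (R : realType) (K : set R) (c rho t : R) :
  closed K -> 1 < rho -> (forall u, K u -> K ((u + c) / rho)) -> K t ->
  K (c / (rho - 1)).
Proof.
move=> Kcl rho1 Kstable Kt.
have rho_neq0 : rho != 0 by rewrite gt_eqF // (lt_trans ltr01).
have rhoB_neq0 : rho - 1 != 0 by rewrite subr_eq0 gt_eqF.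
pose u m := rho^-1 ^+ m * (t - c / (rho - 1)) + c / (rho - 1).
have Ku m : K (u m).
  elim: m => [|m IHm]; first by rewrite /u expr0 mul1r subrK.
  suff -> : u m.+1 = (u m + c) / rho by exact: Kstable.
  by rewrite /u exprS; field; rewrite ?rhoB_neq0 ?rho_neq0.
apply: (@closed_cvg _ _ \oo _ u K) => //; first by near=> m; exact: Ku.
have : u m @[m --> \oo] --> 0 * (t - c / (rho - 1)) + c / (rho - 1).
  apply: cvgD; last exact: cvg_cst.
  apply: cvgM; last exact: cvg_cst.
  apply: cvg_expr; rewrite gtr0_norm ?invr_gt0 ?invf_lt1 //;
    exact: lt_trans ltr01 rho1.
by rewrite mul0r add0r.
Unshelve. all: by end_near. Qed.

Lemma periodic_approximation (R : realType) (r : nat) (A : {set 'I_r})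
    (K : set R) (d : nat -> 'I_r) (y : nat -> R) (B : R) (k l : nat) :
  (1 < r)%N -> is_attractor [set a | a \in A] (@digit_map R r) K ->
  (forall u, K u -> `|u| <= B) -> expansion A K d y -> (k < l)%N ->
  let q := (r ^ k * (r ^ (l - k) - 1))%N in
  exists p : int, K (p%:~R / q%:R) /\
    forall m, (forall s, (s < m)%N -> d (k + s)%N = d (l + s)%N) ->
      `|y 0%N - p%:~R / q%:R| <= 2 * B / (q%:R * r%:R ^+ m).
Proof.
move=> r1 Katt KB dy kl q.
have r0 : (0 < r)%N by exact: ltnW.
have [_ Kcomp _] := Katt.
have Kcl : closed K by apply: compact_closed Kcomp; exact: norm_hausdorff.
have dA s : d s \in A by have [] := dy s.
have rR0 : 0 < r%:R :> R by rewrite ltr0n.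
set rho : R := r%:R ^+ (l - k).
have rho1 : 1 < rho by rewrite exprn_egt1 ?ltr1n // -lt0n subn_gt0.
have rhoB0 : 0 < rho - 1 by rewrite subr_gt0.
have rho0 : 0 < rho by exact: lt_trans ltr01 rho1.
have rk0 : 0 < r%:R ^+ k :> R by rewrite exprn_gt0.
have qE : q%:R = r%:R ^+ k * (rho - 1) :> R.
  by rewrite natrM natrB ?expn_gt0 ?r0 // !natrX.
have q0 : 0 < q%:R :> R by rewrite qE mulr_gt0.
set c := block d k (l - k).
(* The point whose digits are the block [c] repeated for ever; [p / q] puts the first [k] digits of
   [y 0] in front of it. *)
pose z : R := c%:R / (rho - 1).
have Kz : K z.
  have [_ K0 _] := dy 0%N.
  by apply: (closed_affine_fixpoint Kcl rho1 _ K0) => u; exact: (attractor_block _ _ r0 Katt).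
pose p := (block d 0 k * (r ^ (l - k) - 1) + c)%N.
have pE : p%:R / q%:R = (z + (block d 0 k)%:R) / r%:R ^+ k.
  rewrite qE natrD natrM natrB ?expn_gt0 ?r0 // natrX -/rho /z.
  by field; rewrite !gt_eqF.
have yk := expansion_block k (l - k) r0 dy.
rewrite subnKC ?(ltnW kl) // -/rho -/c in yk.
have y0 := expansion_block 0 k r0 dy.
exists p%:Z; rewrite -pmulrn pE; split; first exact: (attractor_block _ _ r0 Katt).
move=> m dE.
(* The common first [k] digits cancel, leaving [(y k - z) / r ^ k]; then [c = rho * y k - y l] gives
   [y k - z = (y l - y k) / (rho - 1)]. *)
have -> : y 0%N - (z + (block d 0 k)%:R) / r%:R ^+ k = (y l - y k) / q%:R.
  rewrite y0 add0n qE yk /z; field.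
  by rewrite !gt_eqF.
have ykm := expansion_block k m r0 dy.
have ylm := expansion_block l m r0 dy.
(* Equal leading blocks cancel; the two remaining tails lie in [K], whence the factor [2 * B]. *)
have -> : y l - y k = (y (l + m)%N - y (k + m)%N) / r%:R ^+ m.
  by rewrite ykm ylm (eq_block dE) -mulrBl; congr (_ / _); ring.
have qrm0 : 0 < q%:R * r%:R ^+ m :> R by rewrite mulr_gt0 ?exprn_gt0.
rewrite -mulrA -invfM [r%:R ^+ m * _]mulrC normrM normfV (gtr0_norm qrm0).
apply: ler_wpM2r; first by rewrite invr_ge0 ltW.
have [_ Kl _] := dy (l + m)%N; have [_ Kk _] := dy (k + m)%N.
by rewrite (le_trans (ler_normB _ _)) // mulr_natl mulr2n lerD // KB.
Qed.

(** Without truncation the product would be exactly [N], as taking logarithms and using the sum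
    condition shows. Truncating only lowers it, since each [c i] is at least 1. *)
Lemma prod_expn_trunc_le (R : realType) (n N : nat) (b : R) (c : 'I_n -> nat)
    (t : 'I_n -> R) :
  1 < b -> (0 < N)%N -> (forall i, (0 < c i)%N) -> (forall i, 0 <= t i) ->
  \sum_(i < n) t i * (ln (c i)%:R / ln b) = 1 ->
  (\prod_(i < n) c i ^ Num.truncn (t i * (ln N%:R / ln b)) <= N)%N.
Proof.
move=> b1 N0 c0 t0 sum1.
have lnb : 0 < ln b by exact: ln_gt0.
have lnN : 0 <= ln N%:R / ln b :> R.
  by rewrite divr_ge0 ?ln_ge0 ?ler1n // ltW.
have pos k : (0 < k)%N -> (k%:R : R) = expR (ln k%:R).
  by move=> k0; rewrite lnK // posrE ltr0n.
rewrite -(ler_nat R) natr_prod [leRHS](pos N) //.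
rewrite (eq_bigr (fun i => expR ((Num.truncn (t i * (ln N%:R / ln b)))%:R
    * ln (c i)%:R))) => [|i _]; last first.
  by rewrite natrX expRM_natl -(pos (c i)).
rewrite -expR_sum ler_expR -[leRHS]mul1r -[X in _ <= X * _]sum1 mulr_suml.
apply: ler_sum => i _.
have tr : (Num.truncn (t i * (ln N%:R / ln b)))%:R <= t i * (ln N%:R / ln b).
  by rewrite truncn_le mulr_ge0.
have lnc : 0 <= ln (c i)%:R :> R by rewrite ln_ge0 // ler1n.
apply: le_trans (ler_wpM2r lnc tr) _.
rewrite le_eqVlt; apply/orP; left; apply/eqP; ring.
Qed.

Lemma powR_le_expr_trunc (R : realType) (b N t : R) :
  1 < b -> 1 <= N -> 0 <= t ->
  N `^ t <= b ^+ (Num.truncn (t * (ln N / ln b))).+1.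
Proof.
move=> b1 N1 t0.
have b0 : 0 < b by exact: lt_trans ltr01 b1.
have lnb : 0 < ln b by exact: ln_gt0.
have x0 : 0 <= t * (ln N / ln b) by rewrite mulr_ge0 // divr_ge0 ?ln_ge0 // ltW.
rewrite /powR gt_eqF ?(lt_le_trans ltr01) //.
rewrite -[X in _ <= X ^+ _]lnK ?posrE // -expRM_natl ler_expR -ler_pdivrMr // -mulrA.
by have /andP[_ /ltW] := truncn_itv x0.
Qed.

Lemma repeated_word (n r N : nat) (A : 'I_n -> {set 'I_r}) (m : 'I_n -> nat)
    (d : 'I_n -> nat -> 'I_r) :
  (forall i k, d i k \in A i) -> (\prod_(i < n) #|A i| ^ m i <= N)%N ->
  exists k l, [/\ (k < l)%N, (l <= N)%N &
    forall i s, (s < m i)%N -> d i (k + s)%N = d i (l + s)%N].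
Proof.
move=> dA cardA.
(* Words of different lengths, one for each [i], are packed into a single function on dependent
   pairs, so that [card_family] counts them as a product. *)
pose word (k : 'I_N.+1) : {ffun {i : 'I_n & 'I_(m i)} -> 'I_r} :=
  [ffun u : {i : 'I_n & 'I_(m i)} => d (tag u) (k + tagged u)%N].
pose W := family (fun u : {i : 'I_n & 'I_(m i)} => [pred a in A (tag u)]).
have cardW : (#|W : {pred {ffun {i : 'I_n & 'I_(m i)} -> 'I_r}}| <= N)%N.
  rewrite card_family foldrE big_map big_enum /=.
  apply: leq_trans cardA.
  rewrite (eq_bigr (fun i => \prod_(s < m i) #|A i|)%N) => [|i _]; last first.
    by rewrite prod_nat_const card_ord.
  by rewrite sig_big_dep /= leq_eqVlt; apply/orP; left; apply/eqP; apply: eq_bigr.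
have /dinjectivePn : ~~ dinjectiveb word predT.
  apply/negP => /dinjectiveP wordI.
  suff: (#|'I_N.+1| <= N)%N by rewrite card_ord ltnn.
  rewrite -(card_in_image wordI); apply: leq_trans cardW.
  apply: subset_leq_card; apply/fintype.subsetP => _ /mapP[k _ ->].
  by apply/familyP => u; rewrite ffunE inE.
move=> [k _ [l lk wkl]].
have eqd i s : (s < m i)%N -> d i (k + s)%N = d i (l + s)%N.
  move=> sm; have /ffunP/(_ (Tagged (fun i => 'I_(m i)) (Ordinal sm))) := wkl.
  by rewrite !ffunE.
move: lk; rewrite !inE /= => /negP lk.
(* The pigeonhole gives two distinct positions in no particular order. *)
have := ltnP k l; case=> [kl|].
  by exists k, l; split=> //; rewrite -ltnS.
rewrite leq_eqVlt => /predU1P[/val_inj lk'|lk'].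
  by case: lk; rewrite lk' eqxx.
by exists l, k; split=> // [|i s sm]; rewrite ?eqd // -ltnS.
Qed.

Theorem theorem7p2 (R : realType) (n r : nat) (n_ge1 : (1 <= n)%N)
    (r_ge2 : (2 <= r)%N) (A : 'I_n -> {set 'I_r})
    (A_neq0 : forall j, A j != finset.set0)
    (K : 'I_n -> set R)
    (K_attractor : forall j,
      is_attractor [set a | a \in A j] (@digit_map R r) (K j))
    (tau : 'rV[R]_n) (tau_ge0 : forall i, 0 <= tau ord0 i)
    (tau_sum : \sum_(i < n) tau ord0 i * digit_dim R (A i) = 1) :
  exists C : R, 0 < C /\
    forall (x : 'rV[R]_n) (Q : R), box K x -> r%:R < Q ->
      exists (p : 'rV[int]_n) (q : nat),
        [/\ (0 < q)%N,
            q%:R <= Q,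
            box K (\row_(i < n) ((p ord0 i)%:~R / q%:R)) &
            forall i : 'I_n,
              `|x ord0 i - (p ord0 i)%:~R / q%:R|
                < C / (q%:R * ln Q `^ tau ord0 i)].
Proof.
have r0 : (0 < r)%N by exact: ltnW.
have r1 : 1 < r%:R :> R by rewrite ltr1n.
have rR0 : 0 < r%:R :> R by rewrite ltr0n.
have lnr : 0 < ln r%:R :> R by exact: ln_gt0.
have [B BK] : {B : 'I_n -> R & forall i u, K i u -> `|u| <= B i}.
  apply: (@choice _ _ (fun i b => forall u, K i u -> `|u| <= b)) => i.
  have [_ Kcomp _] := K_attractor i.
  have [M [_ MK]] := compact_bounded Kcomp.
  by exists (M + 1) => u; apply: MK; rewrite ltrDl.
have B0 i : 0 <= B i.
  by have [[u Ku] _ _] := K_attractor i; exact: le_trans (BK _ _ Ku).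
(* [2 * B i] bounds a difference of tails, [r] pays for truncating [m i], and the last factor for
   replacing [N] by [ln Q]. *)
pose C i := 2 * B i * r%:R * (2 * ln r%:R) `^ tau ord0 i.
have C0 i : 0 <= C i by rewrite !mulr_ge0 ?powR_ge0.
(* The sum dominates every [C i]; adding 1 makes the constant positive and the final inequality
   strict. *)
exists (\sum_(i < n) C i + 1); split; first by rewrite ltr_wpDl // sumr_ge0.
move=> x Q Kx rQ.
have Q0 : 0 < Q by exact: lt_trans rQ.
have Q1 : 1 < Q by exact: lt_trans rQ.
have lnQ : 0 < ln Q by exact: ln_gt0.
have rat1 : 1 <= ln Q / ln r%:R by rewrite ler_pdivlMr // mul1r ler_ln ?posrE // ltW.
pose N := Num.truncn (ln Q / ln r%:R).
have /andP[NQ QN] := truncn_itv (le_trans ler01 rat1); rewrite -/N in NQ QN.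
have N0 : (0 < N)%N by rewrite -ltnS -(ltr_nat R) (le_lt_trans rat1).
have N1 : 1 <= N%:R :> R by rewrite ler1n.
(* [ln Q / ln r < N + 1 <= 2 * N], where [N >= 1] comes from [Q > r]. *)
have lnQ_le : ln Q <= 2 * ln r%:R * N%:R.
  rewrite mulrAC -ler_pdivrMr //; apply: le_trans (ltW QN) _.
  by rewrite mulr_natl mulr2n -natr1 lerD2l.
have [f fP] : {f : 'I_n -> (nat -> 'I_r) * (nat -> R) & forall i,
    expansion (A i) (K i) (f i).1 (f i).2 /\ (f i).2 0%N = x ord0 i}.
  apply: (@choice _ _ (fun i (f : (nat -> 'I_r) * (nat -> R)) =>
    expansion (A i) (K i) f.1 f.2 /\ f.2 0%N = x ord0 i)) => i.
  by have [d [y dy]] := attractor_expansion (K_attractor i) (Kx i); exists (d, y).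
pose m i := Num.truncn (tau ord0 i * (ln N%:R / ln r%:R)).
have A0 i : (0 < #|A i|)%N by rewrite card_gt0.
have dA i k : (f i).1 k \in A i by have [dy _] := fP i; have [] := dy k.
have [k [l [kl lN dE]]] := repeated_word dA
  (prod_expn_trunc_le r1 N0 A0 (fun i => tau_ge0 i) tau_sum).
set q := (r ^ k * (r ^ (l - k) - 1))%N.
have q0 : (0 < q)%N.
  by rewrite muln_gt0 expn_gt0 r0 subn_gt0 -[1%N](expn0 r) ltn_exp2l // subn_gt0.
have [p pP] := choice (fun i =>
  periodic_approximation r_ge2 (K_attractor i) (BK i) (fP i).1 kl).
exists (\row_i p i), q; split => //.
(* [q <= r ^ l <= r ^ N <= Q]. *)
- have qN : (q <= r ^ N)%N.
    apply: leq_trans (leq_pexp2l r0 lN).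
    rewrite [leqRHS](_ : _ = r ^ k * r ^ (l - k))%N; last first.
      by rewrite -expnD subnKC // ltnW.
    by rewrite leq_mul2l leq_subr orbT.
  rewrite -(ler_nat R) natrX in qN; apply: le_trans qN _.
  rewrite -[X in X ^+ _](lnK (x := r%:R)) ?posrE // -expRM_natl.
  by rewrite -[leRHS](lnK (x := Q)) ?posrE // ler_expR -ler_pdivlMr.
- by move=> i; rewrite !mxE; have [] := pP i.
move=> i; rewrite mxE; have [_ /(_ _ (dE i))] := pP i.
rewrite (fP i).2 -/q -/(m i) => /le_lt_trans; apply.
have qR0 : 0 < q%:R :> R by rewrite ltr0n.
have lnQt : 0 < ln Q `^ tau ord0 i by exact: powR_gt0.
have rm0 : 0 < r%:R ^+ m i :> R by exact: exprn_gt0.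
have lnQt_le : ln Q `^ tau ord0 i
    <= (2 * ln r%:R) `^ tau ord0 i * r%:R ^+ (m i).+1.
  have ln2 : 0 <= 2 * ln r%:R :> R by rewrite mulr_ge0 // ltW.
  apply: (@le_trans _ _ ((2 * ln r%:R * N%:R) `^ tau ord0 i)).
    by apply: ge0_ler_powR => //; rewrite nnegrE ?mulr_ge0 // ltW.
  by rewrite powRM // ler_wpM2l ?powR_ge0 // powR_le_expr_trunc.
have CiC : C i < \sum_(j < n) C j + 1.
  by rewrite (bigD1 i) //= -addrA ltrDl ltr_wpDl // sumr_ge0.
apply: (@le_lt_trans _ _ (C i / (q%:R * ln Q `^ tau ord0 i))); last first.
  by rewrite ltr_pM2r // invr_gt0 mulr_gt0.
rewrite ler_pdivrMr ?mulr_gt0 // mulrAC ler_pdivlMr ?mulr_gt0 //.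
rewrite [leLHS](_ : _ = q%:R * (2 * B i) * ln Q `^ tau ord0 i); last by ring.
rewrite [leRHS](_ : _ = q%:R * (2 * B i)
  * ((2 * ln r%:R) `^ tau ord0 i * r%:R ^+ (m i).+1)); last first.
  by rewrite /C (exprS _ (m i)); move: (_ ^+ m i) q%:R => u v; ring.
by apply: ler_wpM2l; rewrite ?mulr_ge0.
Qed.
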